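(* In the comparison query model, given a stable matching instance with one-sided uncertainty and a matching $M$ that is stable, there is a $1$-competitive algorithm for verifying that $M$ is stable, and it uses exactly $\sum_{a\in A} |\{b\in B \mid b \prec_a M(a)\}|$ queries.
   Context: Two disjoint sets $A$, $B$ of agents with $|A|=|B|=n$. Each $a\in A$ has a strict total order $\prec_a$ on $B$ and each $b\in B$ has a strict total order $\prec_b$ on $A$; $x\prec_y z$ means that $y$ prefers $x$ to $z$. A matching is a bijection between $A$ and $B$; $M(a)$ and $M(b)$ denote partners. A pair $(a,b)$ with $b\neq M(a)$ is a blocking pair if $a$ prefers $b$ to $M(a)$ and $b$ prefers $a$ to $M(b)$; $M$ is stable if it has no blocking pair. One-sided uncertainty: the orders $\prec_a$ ($a\in A$) are known initially, the orders $\prec_b$ ($b\in B$) are unknown and are learned only via queries. A comparison query $\mathit{prefer}(b,a_1,a_2)$ (with $b\in B$, $a_1,a_2\in A$) returns whichever of $a_1,a_2$ agent $b$ prefers. An algorithm adaptively makes queries until the known information (the $A$-side preferences and the query answers) proves its output correct, i.e., correct for every $B$-side preference profile consistent with that information. It is $\rho$-competitive if on every instance its number of queries is at most $\rho$ times the minimum size of a query set whose answers on that instance suffice to prove a correct output. For the verification problem (given $M$, verify that $M$ is stable), the competitive ratio is measured only on inputs where $M$ is indeed stable; otherwise the algorithm must detect that $M$ is not stable. *)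

(* Defs.v *)
From mathcomp Require Import all_boot all_order all_algebra.
Set Implicit Arguments.
Unset Strict Implicit.
Unset Printing Implicit Defensive.

(* [P x z] means that the owner of [P] prefers x to z. *)
Record pref (T : Type) := Pref {
  prefers :> T -> T -> bool;
  pref_irr : irreflexive prefers;
  pref_trans : transitive prefers;
  pref_total : forall x z, x <> z -> prefers x z || prefers z x }.

Record matching (A B : Type) := Matching {
  partnerA :> A -> B;
  partnerB : B -> A;
  partnerAK : cancel partnerA partnerB;
  partnerBK : cancel partnerB partnerA }.

Section Verification.
Variables A B : finType.

Definition profileA := A -> pref B.
Definition profileB := B -> pref A.

Definition blocking (PA : profileA) (PB : profileB) (M : matching A B)
    (a : A) (b : B) : bool :=
  [&& b != M a, PA a b (M a) & PB b a (partnerB M b)].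

Definition stable (PA : profileA) (PB : profileB) (M : matching A B) : bool :=
  [forall a, forall b, ~~ blocking PA PB M a b].

(* The triple (b, a1, a2) stands for the query prefer(b, a1, a2). *)
Definition query : finType := (B * A * A)%type.

Definition answer (PB : profileB) (q : query) : A :=
  let: (b, a1, a2) := q in if PB b a1 a2 then a1 else a2.

(* The answers to Q under PB, together with PA, prove the verdict v: it is
   right for every profile of B that yields the same answers.  The verdict
   [true] reads "M is stable" and [false] reads "M is not stable". *)
Definition proves (PA : profileA) (PB : profileB) (M : matching A B)
    (Q : {set query}) (v : bool) : Prop :=
  forall PB' : profileB,
    (forall q, q \in Q -> answer PB' q = answer PB q) -> v = stable PA PB' M.

Definition suffices (PA : profileA) (PB : profileB) (M : matching A B)
    (Q : {set query}) : Prop :=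
  exists v : bool, proves PA PB M Q v.

Definition min_queries (PA : profileA) (PB : profileB) (M : matching A B)
    (k : nat) : Prop :=
  (exists2 Q : {set query}, suffices PA PB M Q & #|Q| = k) /\
  (forall Q : {set query}, suffices PA PB M Q -> k <= #|Q|).

(* Adaptive algorithms: the continuation of [Ask] receives the agent returned
   by the query.  Well-foundedness of the tree is termination. *)
Inductive strategy :=
  | Output of bool
  | Ask of query & (A -> strategy).

Fixpoint asked (PB : profileB) (s : strategy) : seq query :=
  if s is Ask q next then q :: asked PB (next (answer PB q)) else [::].

Fixpoint output (PB : profileB) (s : strategy) : bool :=
  match s with
  | Output v => v
  | Ask q next => output PB (next (answer PB q))
  end.

(* Initially only the A-side preferences and the matching are known. *)
Definition verifier := profileA -> matching A B -> strategy.

(* Repeated queries are counted with multiplicity. *)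
Definition cost (V : verifier) (PA : profileA) (PB : profileB)
    (M : matching A B) : nat :=
  size (asked PB (V PA M)).

(* Required for every M, stable or not. *)
Definition solves (V : verifier) : Prop :=
  forall (PA : profileA) (PB : profileB) (M : matching A B),
    proves PA PB M [set q in asked PB (V PA M)] (output PB (V PA M)).

(* The ratio is measured only on inputs where M is stable. *)
Definition competitive (rho : rat) (V : verifier) : Prop :=
  forall (PA : profileA) (PB : profileB) (M : matching A B),
    stable PA PB M ->
    exists2 k, min_queries PA PB M k
             & ((cost V PA PB M)%:R <= rho * k%:R)%R.

End Verification.

(* Main.v *)
(** The verifier asks, for every pair (a, b) such that a prefers b to M(a), how
    b compares a with M(b).  Conversely, let Q prove that a stable M is stable.
    Every such a must lose some comparison of b in Q: otherwise moving a to the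
    top of b's order changes no answer and makes (a, b) blocking.  As a query of
    b has only one loser, Q has at least as many queries as there are pairs. *)

Require Import Defs.
From mathcomp Require Import all_boot all_order all_algebra.

Set Implicit Arguments.
Unset Strict Implicit.
Unset Printing Implicit Defensive.

Section Raise.
Variables (T : eqType) (P : pref T) (x : T).

(** [P] with [x] moved to the top: nothing beats [x], and the order among the others is kept. *)
Definition raise_rel (y z : T) : bool := (z != x) && ((y == x) || P y z).

Lemma raise_irr : irreflexive raise_rel.
Proof. by move=> y; rewrite /raise_rel pref_irr orbF andNb. Qed.

Lemma raise_trans : transitive raise_rel.
Proof.
move=> y w z /andP[ynx wy] /andP[znx yz]; rewrite /raise_rel znx /=.
case/orP: wy => [->//|wy]; rewrite (negPf ynx) /= in yz.
by rewrite (pref_trans wy yz) orbT.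
Qed.

Lemma raise_total y z : y <> z -> raise_rel y z || raise_rel z y.
Proof.
rewrite /raise_rel => yz; have [zx|znx] := eqVneq z x; have [yx|ynx] //= := eqVneq y x.
  by case: yz; rewrite zx.
exact: pref_total.
Qed.

Definition raise : pref T := Pref raise_irr raise_trans raise_total.

End Raise.

Section Verification.
Variables A B : finType.
Implicit Types (PA : profileA A B) (PB : profileB A B) (M : matching A B).

(** A non-adaptive strategy: answers affect only the accumulated verdict [v], never the later
    queries. *)
Fixpoint ask_all (c : query A B -> A -> bool) (s : seq (query A B)) (v : bool) :
    strategy A B :=
  if s is q :: s' then Ask q (fun x => ask_all c s' (v && c q x))
  else Output _ _ v.

Lemma asked_ask_all c s v PB : asked PB (ask_all c s v) = s.
Proof. by elim: s v => //= q s IHs v; rewrite IHs. Qed.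

Lemma output_ask_all c s v PB :
  output PB (ask_all c s v) = v && all (fun q => c q (answer PB q)) s.
Proof. by elim: s v => [|q s IHs] v /=; rewrite ?andbT // IHs andbA. Qed.

Definition tempting PA M : {set B * A} := [set p | PA p.2 p.1 (M p.2)].

Definition tempting_query M (p : B * A) : query A B :=
  (p.1, p.2, partnerB M p.1).

Lemma tempting_query_inj M : injective (tempting_query M).
Proof. by case=> b a [b' a'] [-> ->]. Qed.

Lemma card_tempting PA M :
  #|tempting PA M| = \sum_(a : A) #|[set b : B | PA a b (M a)]|.
Proof.
under eq_bigr => a _ do rewrite -sum1dep_card.
rewrite (exchange_big_dep xpredT) //= pair_big_dep /= -sum1dep_card.
by apply: eq_bigl.
Qed.

(** Irreflexivity gives the first inequality, bijectivity of [M] the second. Thus [tempting_query]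
    compares two distinct agents, and its answer reveals which one [b] prefers. *)
Lemma tempting_neq PA M b a : (b, a) \in tempting PA M ->
  (b != M a) && (a != partnerB M b).
Proof.
rewrite inE /= => ab; have bM : b != M a.
  by apply: contraTneq ab => ->; rewrite pref_irr.
by rewrite bM; apply: contraNneq bM => ->; rewrite partnerBK.
Qed.

Lemma stable_tempting PA PB M :
  stable PA PB M = [forall p in tempting PA M, ~~ PB p.1 p.2 (partnerB M p.1)].
Proof.
apply/forallP/forall_inP => [st [b a] ab|st a].
  have /forallP/(_ b) := st a; have /andP[bM _] := tempting_neq ab.
  by move: ab; rewrite inE /blocking bM /= => ->.
apply/forallP => b; apply/negP => /and3P[_ ab ba].
by have := st (b, a); rewrite inE /= ab ba => /(_ isT).
Qed.

(** Here [q.2] is the partner of [b], so a check fails exactly when the pair blocks. *)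
Definition verify : verifier A B := fun PA M =>
  ask_all (fun q x => x == q.2) [seq tempting_query M p | p <- enum (tempting PA M)]
    true.

Lemma output_verify PA PB M : output PB (verify PA M) = stable PA PB M.
Proof.
rewrite output_ask_all all_map stable_tempting /=.
apply/allP/forall_inP => [h [b a] ab|h [b a]].
  have := h (b, a); rewrite mem_enum => /(_ ab) /=.
  by have /andP[_ /negPf aM] := tempting_neq ab; case: ifP; rewrite ?aM.
by rewrite mem_enum => /h /= /negPf ->.
Qed.

(** The query list is the same for all profiles and the output is always right, so a profile with
    equal answers yields the same, again correct, verdict. *)
Lemma verify_solves : solves verify.
Proof.
move=> PA PB M PB' eqPB; rewrite -output_verify !output_ask_all.
congr (_ && _); apply: eq_in_all => q qL; rewrite eqPB // inE.
by rewrite asked_ask_all.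
Qed.

Lemma cost_verify PA PB M : cost verify PA PB M = #|tempting PA M|.
Proof. by rewrite /cost asked_ask_all size_map -cardE. Qed.

Definition loser PB (q : query A B) : B * A :=
  let: (b, a1, a2) := q in (b, if PB b a1 a2 then a2 else a1).

Definition promote PB (b : B) (a : A) : profileB A B :=
  fun b' => if b' == b then raise (PB b) a else PB b'.

(** A query of [b] that [a] does not lose either omits [a] or is already won by [a]; raising [a]
    alters neither outcome. *)
Lemma answer_promote PB b a q :
  loser PB q != (b, a) -> answer (promote PB b a) q = answer PB q.
Proof.
case: q => [[b' a1] a2] /=; rewrite /promote xpair_eqE.
have [->|//] := eqVneq b' b; rewrite /= /raise_rel.
have [->|a2a] /= := eqVneq a2 a; first by case: ifP; rewrite ?eqxx.
have [->|//] := eqVneq a1 a; by case: ifP; rewrite ?eqxx.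
Qed.

Lemma tempting_sub_losers PA PB M (Q : {set query A B}) :
  stable PA PB M -> suffices PA PB M Q -> tempting PA M \subset loser PB @: Q.
Proof.
move=> st [v pv]; apply/subsetP => -[b a] ab; apply/negPn/negP => nQ.
(* The true profile [PB] is itself consistent with the answers. *)
have vT : v = true by rewrite -st; apply: pv.
have stP : stable PA (promote PB b a) M.
  rewrite -pv ?vT // => q qQ; apply: answer_promote.
  by apply: contraNneq nQ => <-; apply: imset_f.
move: stP; rewrite stable_tempting => /forall_inP/(_ _ ab)/negP; apply.
have /andP[_ aM] := tempting_neq ab.
by rewrite /promote eqxx /= /raise_rel eqxx eq_sym aM.
Qed.

Lemma min_queries_stable PA PB M :
  stable PA PB M -> min_queries PA PB M #|tempting PA M|.
Proof.
move=> st; split=> [|Q sQ].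
  exists [set q in asked PB (verify PA M)].
    by exists (output PB (verify PA M)); apply: verify_solves.
  (* No query is repeated, so the set is as large as the list. *)
  rewrite asked_ask_all cardsE (card_uniqP _) ?size_map -?cardE //.
  by rewrite (map_inj_uniq (@tempting_query_inj M)) enum_uniq.
exact: leq_trans (subset_leq_card (tempting_sub_losers st sQ)) (leq_imset_card _ _).
Qed.

End Verification.

Theorem theorem4 :
  exists V : forall A B : finType, verifier A B,
  forall (n : nat) (A B : finType), #|A| = n -> #|B| = n ->
    [/\ solves (V A B),
        competitive 1%R (V A B)
      & forall (PA : profileA A B) (PB : profileB A B) (M : matching A B),
          stable PA PB M ->
          cost (V A B) PA PB M
            = \sum_(a : A) #|[set b : B | PA a b (M a)]|].
Proof.
exists @verify => n A B _ _; split=> [|PA PB M st|PA PB M _].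
- exact: verify_solves.
- exists #|tempting PA M|; first exact: min_queries_stable.
  by rewrite cost_verify GRing.mul1r.
- by rewrite cost_verify card_tempting.
Qed.
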